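(* For $n\ge1$ let $A_n(t)=\sum_{\pi\in\mathrm{RSP}(n)}t^{\mathrm{des}(\pi)}$. Then \[ \sum_{n\ge0}A_{n+1}(t)\frac{u^n}{n!}=e^u\exp\!\big(t(e^u-u-1)\big). \]
   Context: For $\pi\in S_n$ in one-line notation, $k\in[n-1]$ is a descent if $\pi(k)>\pi(k+1)$, and $\mathrm{des}(\pi)$ is the number of descents. The runs of $\pi$ are its maximal increasing contiguous subwords; $\mathrm{runsort}(\pi)$ is obtained by rearranging the runs of $\pi$ in lexicographic order (i.e. by increasing first entries); $\mathrm{RSP}(n)=\{\mathrm{runsort}(\sigma):\sigma\in S_n\}$. The identity is of formal power series in $u$ with coefficients in $\mathbb{Q}[t]$. *)

(* Defs.v *)
From mathcomp Require Import all_boot all_order all_fingroup all_algebra.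

Set Implicit Arguments.
Unset Strict Implicit.
Unset Printing Implicit Defensive.

Import GRing.Theory.

(* One-line notation. Positions and values are numbered from 0 instead of 1;
   descents, runs and runsort only depend on the relative order of the letters. *)
Definition word (n : nat) (s : 'S_n) : seq nat :=
  [seq val (s i) | i <- enum 'I_n].

(* With 0-based positions, k is a descent when 0 <= k < n - 1. *)
Definition descents (n : nat) (s : 'S_n) : {set 'I_n.-1} :=
  [set k : 'I_n.-1 | nth 0 (word s) k > nth 0 (word s) k.+1].

Definition des (n : nat) (s : 'S_n) : nat := #|descents s|.

(* The maximal increasing contiguous subwords, from left to right;
   runs_spec below proves that this is what is computed. *)
Fixpoint runs (w : seq nat) : seq (seq nat) :=
  if w is x :: w' then
    match runs w' with
    | (y :: r) :: rs =>
        if x < y then (x :: y :: r) :: rs else [:: x] :: (y :: r) :: rs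
    | rs => [:: x] :: rs
    end
  else [::].

Definition lexi_le : rel (seq nat) :=
  fun r1 r2 => ((r1 : seqlexi nat) <= (r2 : seqlexi nat))%O.

Definition runsort (w : seq nat) : seq nat := flatten (sort lexi_le (runs w)).

(* runsort_word below shows that every runsort (word s) is again the one-line
   notation of a permutation, so no word is lost here. *)
Definition RSP (n : nat) : {set 'S_n} :=
  [set p : 'S_n | [exists s : 'S_n, word p == runsort (word s)]].

Local Open Scope ring_scope.

Definition A (n : nat) : {poly rat} := \sum_(p in RSP n) 'X^(des p).

(* A formal power series in u is its sequence of coefficients. *)
Definition fps (R : Type) : Type := nat -> R.

Section FormalPowerSeries.
Variable R : comAlgType rat.
Implicit Types f g : fps R.

Definition fps_one : fps R := fun n => (n == 0%N)%:R.
Definition fps_u : fps R := fun n => (n == 1%N)%:R.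
Definition fps_sub f g : fps R := fun n => f n - g n.
Definition fps_scale (c : R) f : fps R := fun n => c * f n.
Definition fps_mul f g : fps R := fun n => \sum_(i < n.+1) f i * g (n - i)%N.
Definition fps_exp_nat f k : fps R := iter k (fps_mul f) fps_one.

(* exp f = sum_k f^k / k!, for f with zero constant term: by fps_exp_nat_eq0,
   only the terms with k <= n contribute to the coefficient of u^n. *)
Definition fps_exp f : fps R :=
  fun n => \sum_(k < n.+1) (k`!%:R^-1 : rat) *: fps_exp_nat f k n.

Lemma fps_exp_nat_eq0 f k n :
  f 0%N = 0 -> (n < k)%N -> fps_exp_nat f k n = 0.
Proof.
move=> f0; elim: k n => // k IHk n lt_nk.
rewrite /fps_exp_nat iterS -/(fps_exp_nat f k) /fps_mul big1 // => -[[|i] lt_i] _ /=.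
  by rewrite f0 mul0r.
by rewrite IHk ?mulr0 //; case: n lt_nk lt_i => // n lt_nk _; rewrite subSS (leq_ltn_trans (leq_subr _ _)).
Qed.

End FormalPowerSeries.

Arguments fps_one {R}.
Arguments fps_u {R}.

(* The exponential generating function sum_n a_n u^n / n!. *)
Definition egf (R : comAlgType rat) (a : nat -> R) : fps R :=
  fun n => (n`!%:R^-1 : rat) *: a n.

Lemma fps_exp_u (R : comAlgType rat) :
  fps_exp (@fps_u R) =1 egf (fun=> 1).
Proof.
have powE k n : fps_exp_nat (@fps_u R) k n = (n == k)%:R.
  elim: k n => // k IHk n; rewrite /fps_exp_nat iterS -/(fps_exp_nat _ k) /fps_mul.
  rewrite big_ord_recl /= mul0r add0r.
  case: n => [|n]; first by rewrite big_ord0.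
  rewrite big_ord_recl /= mul1r subSS subn0 IHk big1 ?addr0 // => i _.
  by rewrite /fps_u /= mul0r.
move=> n; rewrite /fps_exp /egf big_ord_recr /= big1 => [|i _].
  by rewrite powE eqxx add0r.
by rewrite powE gtn_eqF ?scaler0.
Qed.

Local Close Scope ring_scope.

Lemma flatten_runs w : flatten (runs w) = w.
Proof.
elim: w => //= x w; case: (runs w) => [|[|y r] rs] /= IHw; rewrite -{}IHw //.
by case: ifP.
Qed.

Lemma runs_spec w :
  [/\ flatten (runs w) = w,
      all (fun r => (r != [::]) && sorted ltn r) (runs w)
    & sorted (fun r1 r2 => last 0 r1 >= head 0 r2) (runs w)].
Proof.
split; first exact: flatten_runs.
  elim: w => //= x w; case: (runs w) => [|[|y r] rs] //= /andP[r_s rs_s].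
  by case: ifP => /= [->|_]; rewrite r_s rs_s.
elim: w => //= x w; case: (runs w) => [|[|y r] rs] //= IHw.
by case: ltnP => /= [_|->] //; case: rs IHw.
Qed.

Lemma runsort_word n (s : 'S_n) : exists p : 'S_n, word p = runsort (word s).
Proof.
have word_perm : perm_eq (runsort (word s)) (iota 0 n).
  have sort_perm : perm_eq (runsort (word s)) (word s).
    rewrite -[X in perm_eq _ X]flatten_runs.
    by apply: perm_flatten; rewrite perm_sort.
  apply: perm_trans sort_perm _.
  rewrite /word map_comp -val_enum_ord; apply: perm_map.
  apply: uniq_perm; rewrite ?(map_inj_uniq perm_inj) ?enum_uniq // => i.
  by rewrite !mem_enum; apply/mapP; exists (s^-1%g i); rewrite ?mem_enum ?permKV.
set w := runsort _ in word_perm *.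
have size_w : size w = n by rewrite (perm_size word_perm) size_iota.
have w_lt (i : 'I_n) : nth 0 w i < n.
  have: nth 0 w i \in w by rewrite mem_nth ?size_w.
  by rewrite (perm_mem word_perm) mem_iota.
have f_inj : injective (fun i => Ordinal (w_lt i)).
  move=> i j /(congr1 val) /= /eqP; rewrite nth_uniq ?size_w //.
    by move/eqP/val_inj.
  by rewrite (perm_uniq word_perm) iota_uniq.
exists (perm f_inj); apply: (@eq_from_nth _ 0); first by rewrite size_map size_enum_ord.
rewrite size_map size_enum_ord => k lt_kn.
by rewrite (nth_map (Ordinal lt_kn)) ?size_enum_ord // permE /= nth_enum_ord.
Qed.

(* Main.v *)
(* A word lies in RSP exactly when each letter y following a letter x either exceeds x
   or is the smallest letter not yet used.  Summing over the next letter, the generating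
   function of the completions of a prefix ending in x, with set s of unused letters, is a
   function of the numbers a and b of letters of s below and above x; if a > 0 it is
   t * sum_i C(b,i) A_(a+b-i), since the current run takes i of the b larger letters and
   the next run starts with the least unused letter.  For a = 0 this yields
   A_(n+2) = A_(n+1) + t * sum_(i >= 1) C(n,i) A_(n+1-i), which is the differential
   equation B' = (1 + t(e^u - 1)) B satisfied by the right-hand side. *)
Require Import Defs.
From mathcomp Require Import all_boot all_order all_fingroup all_algebra.

Set Implicit Arguments.
Unset Strict Implicit.
Unset Printing Implicit Defensive.

Import GRing.Theory.

(** * Characterisation of [RSP] by the heads of runs *)

(* Here x is the letter preceding w; with x larger than all letters of w, the first
   letter of w is also forced to be minimal, and counts as a descent in ndes. *)
Fixpoint min_heads (x : nat) (w : seq nat) : bool :=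
  if w is y :: w' then ((x < y) || all (leq y) w') && min_heads y w' else true.

Fixpoint ndes (x : nat) (w : seq nat) : nat :=
  if w is y :: w' then (y < x) + ndes y w' else 0.

Lemma ndes_card x w :
  ndes x w = #|[set k : 'I_(size w) | nth 0 (x :: w) k > nth 0 (x :: w) k.+1]|.
Proof.
rewrite -sum1dep_card big_mkcond /=.
elim: w x => [|y w IHw] x /=; first by rewrite big_ord0.
by rewrite big_ord_recl IHw /=; case: ltnP.
Qed.

Lemma min_heads_cat x r w :
  path ltn x r -> min_heads x (r ++ w) = min_heads (last x r) w.
Proof. by elim: r x => //= y r IHr x /andP[-> /IHr]. Qed.

(** A head is at most the rest of its own run, which increases, and at most each later run, whose
    head is no smaller. The list [rs] is arbitrary so that it can be a sorted list of runs. *)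
Lemma min_heads_flatten x rs :
  all (fun r => (r != [::]) && sorted ltn r) rs ->
  sorted leq (map (head 0) rs) -> min_heads x (flatten rs).
Proof.
elim: rs x => // -[|y r] // rs IHrs x /= /andP[r_lt rs_runs] heads_le.
rewrite min_heads_cat // (IHrs _ rs_runs (path_sorted heads_le)) andbT.
apply/orP; right; rewrite all_cat; apply/andP; split.
  by apply: sub_all (order_path_min ltn_trans r_lt) => z /ltnW.
have /allP heads_ge := order_path_min leq_trans heads_le.
apply/allP => z /flattenP[[|h q] q_in]; rewrite // => z_in.
apply: (leq_trans (heads_ge h _)); first by apply/mapP; exists (h :: q).
have /andP[_ q_lt] := allP rs_runs _ q_in.
move: z_in; rewrite inE => /predU1P[-> //|].
by move/(allP (order_path_min ltn_trans q_lt))/ltnW.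
Qed.

Lemma runs_cons x w : exists r rs, runs (x :: w) = (x :: r) :: rs.
Proof.
rewrite /=; case: (runs w) => [|[|y r] rs]; [by exists [::], [::]|by exists [::], [:: [::] & rs]|].
by case: ifP; [exists (y :: r), rs|exists [::], ((y :: r) :: rs)].
Qed.

Lemma all_heads (a : pred nat) w : all a w -> all a (map (head 0) (runs w)).
Proof.
rewrite -{1}(flatten_runs w); have [_ w_runs _] := runs_spec w.
elim: (runs w) w_runs => // -[|y r] // rs IHrs /= /andP[_ rs_runs].
by rewrite all_cat => /andP[-> /andP[_ /(IHrs rs_runs)]].
Qed.

(** A letter opens a new run only if it does not exceed its predecessor, so it must be minimal among
    what follows, later heads included. The first head escapes this when it exceeds [x], hence
    [behead]. *)
Lemma min_heads_sorted x w :
  min_heads x w -> sorted leq (behead (map (head 0) (runs w))).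
Proof.
elim: w x => //= y [|z w] IHw x //; rewrite {1}/min_heads -/min_heads.
case/andP=> _ w_min; have := IHw y w_min.
have zw_min : all (leq z) w -> all (leq z) (z :: w) by rewrite /= leqnn.
have [r [rs runs_zw]] := runs_cons z w; rewrite runs_zw.
case: ltnP => // le_zy heads_le /=; rewrite path_min_sorted //.
case/andP: w_min; rewrite ltnNge le_zy /= => /zw_min/all_heads.
by rewrite runs_zw => /= /andP[].
Qed.

Lemma lexi_le_head r1 r2 : lexi_le r1 r2 -> head 0 r1 <= head 0 r2.
Proof.
by case: r1 r2 => [|x r1] [|y r2] //; rewrite /lexi_le Order.SeqLexiOrder.Exports.lexi_cons => /andP[].
Qed.

Lemma ltn_head_lexi_le r1 r2 : head 0 r1 < head 0 r2 -> lexi_le r1 r2.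
Proof.
case: r1 r2 => [|x r1] [|y r2] //= lt_xy.
by rewrite /lexi_le Order.SeqLexiOrder.Exports.lexi_cons !leEnat (ltnW lt_xy) leqNgt lt_xy.
Qed.

(** This makes weakly increasing heads strictly increasing, and strict order of heads decides the
    lexicographic order. *)
Lemma uniq_heads w : uniq w -> uniq (map (head 0) (runs w)).
Proof.
rewrite -{1}(flatten_runs w); have [_ w_runs _] := runs_spec w.
elim: (runs w) w_runs => // -[|y r] // rs IHrs /= /andP[_ rs_runs].
rewrite cat_uniq mem_cat negb_or => /andP[/andP[_ y_rs] /and3P[_ _ /(IHrs rs_runs) ->]].
rewrite andbT; apply: contra y_rs => /mapP[q q_in ->].
apply/flattenP; exists q => //; have := allP rs_runs q q_in.
by case: (q) => // a l _; rewrite mem_head.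
Qed.

Lemma mem_RSP n (p : 'S_n) : (p \in RSP n) = min_heads n (word p).
Proof.
have uniq_word : uniq (word p).
  rewrite map_inj_uniq ?enum_uniq // => i j; by move/val_inj/perm_inj.
have lexi_total : total lexi_le by move=> r1 r2; apply: Order.TotalTheory.le_total.
have lexi_trans : transitive lexi_le by move=> r1 r2 r3; apply: Order.POrderTheory.le_trans.
rewrite inE; apply/existsP/idP => [[s /eqP ->]|p_min].
  have [_ s_runs _] := runs_spec (word s).
  apply: min_heads_flatten; first by rewrite all_sort.
  rewrite sorted_map; apply: sub_sorted (sort_sorted lexi_total _) => r1 r2.
  exact: lexi_le_head.
(* The runs of [p] are already sorted, so [p] is its own preimage. *)
exists p; rewrite /runsort sorted_sort ?flatten_runs //.
suff: sorted ltn (map (head 0) (runs (word p))).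
  by rewrite sorted_map; apply: sub_sorted => r1 r2; apply: ltn_head_lexi_le.
rewrite ltn_sorted_uniq_leq uniq_heads //=.
have := min_heads_sorted p_min; have word_lt : all (ltn^~ n) (word p).
  by apply/allP => _ /mapP[i _ ->] /=.
case Ew: (word p) p_min word_lt => [|y w] //= /andP[+ _] /andP[lt_yn _].
(* The start value [n] exceeds every letter, so the first letter is forced to be minimal; this
   settles the head that [behead] left out. *)
rewrite ltnNge ltnW //= => y_min; have yw_min : all (leq y) (y :: w) by rewrite /= leqnn.
have := all_heads yw_min; have [r [rs /= ->]] := runs_cons y w => /= /andP[_ le_y] heads_le.
by rewrite path_min_sorted.
Qed.

(** * The polynomial [A] as a sum over words *)

Local Open Scope ring_scope.

(** The extra descent goes from the start value [n.+1] to the first letter. *)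
Lemma des_ndes n (p : 'S_n.+1) : (des p).+1 = ndes n.+1 (word p).
Proof.
have size_p : size (word p) = n.+1 by rewrite size_map size_enum_ord.
have: all (ltn^~ n.+1) (word p) by apply/allP => _ /mapP[i _ ->] /=.
rewrite /des /descents; case: (word p) size_p => //= x w [<-] /andP[-> _].
by rewrite ndes_card.
Qed.

Definition remaining_sum (x : nat) (s : seq nat) : {poly rat} :=
  \sum_(w <- permutations s | min_heads x w) 'X^(ndes x w).

Lemma A_remaining n : 'X * A n.+1 = remaining_sum n.+1 (iota 0 n.+1).
Proof.
have word_inj : injective (@word n.+1).
  move=> p q eq_pq; apply/permP => i; apply: val_inj.
  have := congr1 (fun w => nth 0%N w i) eq_pq.
  by rewrite /= !(nth_map i 0%N) ?size_enum_ord // nth_ord_enum.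
have word_perm (p : 'S_n.+1) : perm_eq (word p) (iota 0 n.+1).
  rewrite /word map_comp -val_enum_ord; apply: perm_map.
  apply: uniq_perm; rewrite ?(map_inj_uniq perm_inj) ?enum_uniq // => i.
  by rewrite !mem_enum; apply/mapP; exists (p^-1%g i); rewrite ?mem_enum ?permKV.
have perm_words : perm_eq (map (@word n.+1) (enum 'S_n.+1)) (permutations (iota 0 n.+1)).
  have words_uniq : uniq (map (@word n.+1) (enum 'S_n.+1)).
    by rewrite map_inj_uniq ?enum_uniq.
  apply: uniq_perm; rewrite ?permutations_uniq //.
  (* Distinct words, as many as there are permutations of the letters, exhaust them. *)
  apply: (uniq_min_size words_uniq _ _).2 => [_ /mapP[p _ ->]|].
    by rewrite mem_permutations.
  by rewrite size_permutations ?iota_uniq // size_iota size_map -cardE card_Sn.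
rewrite /remaining_sum -(perm_big _ perm_words) big_map big_enum_cond mulr_sumr /=.
by apply: eq_big => [p|p _]; rewrite ?mem_RSP // -exprS des_ndes.
Qed.

(** * Recurrence over the next letter and its solution *)

Lemma remaining_sum_rec x s : uniq s -> s != [::] ->
  remaining_sum x s = \sum_(y <- s | (x < y)%N || all (leq y) s)
    'X^(y < x) * remaining_sum y (rem y s).
Proof.
move=> s_uniq s_neq0; have s_gt0 : (0 < size s)%N by case: (s) s_neq0.
rewrite /remaining_sum (perm_big _ (permutationsE s_gt0)) /=.
rewrite undup_id // big_mkcond big_allpairs_dep /= [RHS]big_mkcond /=.
apply: eq_big_seq => y y_s; rewrite -big_mkcond /=.
(* Minimality of [y] depends only on the set of letters, so it is the same for all completions
   [w]. *)
have allE w : w \in permutations (rem y s) -> all (leq y) w = all (leq y) s.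
  rewrite mem_permutations => /perm_all->.
  by rewrite (perm_all _ (perm_to_rem y_s)) /= leqnn.
rewrite big_seq_cond; case: ifP => [xy_ok|xy_no].
  rewrite mulr_sumr [RHS]big_seq_cond; apply: eq_big => [w|w _].
    by case w_in: (w \in _); rewrite //= allE // xy_ok.
  by rewrite -exprD.
by rewrite big1 // => w /andP[/allE->]; rewrite xy_no.
Qed.

(** Hockey-stick identity: a choice of [i.+1] letters above [x] is its least letter [y] and [i]
    letters above [y]. *)
Lemma sum_bin_gt i x s : sorted ltn s ->
  (\sum_(y <- s | x < y) 'C(count (ltn y) s, i) = 'C(count (ltn x) s, i.+1))%N.
Proof.
elim: s => [|y s IHs] /= ys_lt; first by rewrite big_nil.
have y_lt := order_path_min ltn_trans ys_lt; have s_lt := path_sorted ys_lt.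
have count_y : count (ltn y) s = size s by apply/eqP; rewrite -all_count.
have countE z : (y <= z)%N -> (z < y)%N = false by rewrite leqNgt => /negbTE.
rewrite big_cons /= ltnn add0n.
have restE : (\sum_(z <- s | x < z) 'C((z < y) + count (ltn z) s, i) =
   \sum_(z <- s | x < z) 'C(count (ltn z) s, i))%N.
  rewrite big_seq_cond [RHS]big_seq_cond; apply: eq_bigr => z /andP[/(allP y_lt) lt_yz _].
  by rewrite countE // ltnW.
rewrite restE IHs //; case: ltnP => [lt_xy|//].
have count_x : count (ltn x) s = size s.
  by apply/eqP; rewrite -all_count; apply: sub_all y_lt => z; apply: ltn_trans.
by rewrite count_x count_y add1n binS addnC.
Qed.

(* A_(n+1) is not known to satisfy the recurrence beforehand: G is any solution of it,
   so that G n = A_(n+1) comes out as a consequence. *)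
Lemma remaining_sum_closed (G : nat -> {poly rat}) x s :
    G 0%N = 1 ->
    (forall n, G n.+1 = G n + 'X * \sum_(i < n) G (n - i.+1)%N *+ 'C(n, i.+1)) ->
    sorted ltn s -> x \notin s ->
  remaining_sum x s =
    if has (ltn^~ x) s
    then 'X * \sum_(i < size s) G (size s - i.+1)%N *+ 'C(count (ltn x) s, i)
    else G (size s).
Proof.
move=> G0 GS; have [n] := ubnP (size s); elim: n x s => // n IHn x s le_sn s_lt x_s.
case: s => [|m s] in le_sn s_lt x_s *.
  by rewrite /remaining_sum /= big_cons big_nil /= addr0 G0.
have m_lt := order_path_min ltn_trans s_lt.
have s_uniq := sorted_uniq ltn_trans ltnn s_lt.
have m_le : all (leq m) (m :: s) by rewrite /= leqnn; apply: sub_all m_lt => z /ltnW.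
have s_sorted := path_sorted s_lt.
rewrite remaining_sum_rec // big_cons m_le orbT /= eqxx.
have -> : remaining_sum m s = G (size s).
  rewrite IHn //; last by case/andP: s_uniq.
  rewrite ifF //; apply/negbTE; rewrite -all_predC; apply: sub_all m_lt => z /=.
  by rewrite -leqNgt => /ltnW.
have -> : \sum_(y <- s | (x < y)%N || ((y <= m)%N && all (leq y) s))
    'X^(y < x) * remaining_sum y (if m == y then s else m :: rem y s) =
  'X * \sum_(i < size s) G (size s - i.+1)%N *+ 'C(count (ltn (maxn x m)) s, i.+1).
  transitivity (\sum_(y <- s | (maxn x m < y)%N) 'X *
     \sum_(i < size s) G (size s - i.+1)%N *+ 'C(count (ltn y) s, i)).
    rewrite big_seq_cond [RHS]big_seq_cond; apply: eq_big => [y|y].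
      case y_s: (y \in s) => //=; have lt_my : (m < y)%N := allP m_lt _ y_s.
      by rewrite gtn_max lt_my andbT (leqNgt y m) lt_my orbF.
    case/andP=> y_s; have lt_my : (m < y)%N := allP m_lt _ y_s; rewrite (ltn_eqF lt_my).
    rewrite (leqNgt y m) lt_my orbF => lt_xy; rewrite ltnNge (ltnW lt_xy) expr0 mul1r.
    have size_rem_y : (size (rem y s)).+1 = size s.
      by rewrite size_rem //; case: (s) y_s.
    have sub_rem : subseq (m :: rem y s) (m :: s) by rewrite /= eqxx rem_subseq.
    rewrite IHn.
    - rewrite /= lt_my /= size_rem_y; congr (_ * _); apply: eq_bigr => i _.
      rewrite (ltnNge y m) (ltnW lt_my) add0n.
      rewrite (seq.permP (perm_to_rem y_s) (ltn y)) /=.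
      by rewrite ltnn.
    - by rewrite /= size_rem_y.
    - exact: (subseq_sorted ltn_trans sub_rem s_lt).
    rewrite inE (gtn_eqF lt_my) /= mem_rem_uniqF //; by case/andP: s_uniq.
  rewrite -mulr_sumr exchange_big /=; congr (_ * _); apply: eq_bigr => i _.
  by rewrite sumrMnr sum_bin_gt.
(* If [x < m], all of [s] lies above [m] and the sum is the recurrence [GS]; if [m < x], the term of
   [m] is the summand [i = 0]. *)
case: (ltngtP x m) => [lt_xm|lt_mx|eq_xm]; last by rewrite eq_xm mem_head in x_s.
  rewrite expr0 mul1r /= ifF; last first.
    apply/negbTE; rewrite -all_predC; apply: sub_all m_lt => z /= lt_mz.
    by rewrite -leqNgt (ltnW (ltn_trans lt_xm lt_mz)).
  by rewrite GS; have /eqP -> : count (ltn m) s == size s by rewrite -all_count.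
by rewrite expr1 -mulrDr big_ord_recl /= subSS subn0 bin0 add0n.
Qed.

(** * Formal derivatives of products and exponentials *)

Section FormalDerivative.
Variable R : comAlgType rat.
Implicit Types f g h : fps R.

Definition fps_deriv f : fps R := fun n => f n.+1 *+ n.+1.

(** Truncating beyond degree [n] keeps this coefficient, so ring laws and the Leibniz rule carry
    over from polynomials. *)
Lemma coef_fps_mul N f g n : (n < N)%N ->
  fps_mul f g n = (\poly_(i < N) f i * \poly_(i < N) g i)`_n.
Proof.
move=> lt_nN; rewrite coefM; apply: eq_bigr => i _; rewrite !coef_poly.
by rewrite (leq_ltn_trans _ lt_nN) ?leq_ord // (leq_ltn_trans (leq_subr _ _) lt_nN).
Qed.

Lemma coef_fps_exp_nat N f k n : (n < N)%N ->
  fps_exp_nat f k n = ((\poly_(i < N) f i) ^+ k)`_n.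
Proof.
elim: k n => [|k IHk] n lt_nN; first by rewrite expr0 coef1.
rewrite exprS coefM /fps_exp_nat iterS -/(fps_exp_nat f k).
apply: eq_bigr => i _; rewrite coef_poly.
by rewrite (leq_ltn_trans _ lt_nN) ?leq_ord // IHk // (leq_ltn_trans (leq_subr _ _) lt_nN).
Qed.

Lemma eq_fps_mul f1 f2 g1 g2 : f1 =1 f2 -> g1 =1 g2 ->
  fps_mul f1 g1 =1 fps_mul f2 g2.
Proof. by move=> eq_f eq_g n; apply: eq_bigr => i _; rewrite eq_f eq_g. Qed.

Lemma fps_mulCA f g h : fps_mul f (fps_mul g h) =1 fps_mul g (fps_mul f h).
Proof.
move=> n; pose p (q : fps R) := \poly_(i < n.+1) q i.
have mulE q r s : fps_mul q (fps_mul r s) n = (p q * (p r * p s))`_n.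
  rewrite coefM; apply: eq_bigr => i _; rewrite coef_poly ltn_ord.
  by rewrite -coef_fps_mul // ltnS leq_subr.
by rewrite !mulE mulrCA.
Qed.

Lemma fps_deriv_mul f g n :
  fps_deriv (fps_mul f g) n =
  fps_mul (fps_deriv f) g n + fps_mul f (fps_deriv g) n.
Proof.
rewrite /fps_deriv (@coef_fps_mul n.+2) // -coef_deriv derivM coefD !coefM.
congr (_ + _); apply: eq_bigr => -[i /= le_in] _; rewrite coef_deriv !coef_poly.
  by rewrite ltnS le_in !ltnS (leq_trans (leq_subr _ _)).
by rewrite (leqW le_in) !ltnS leq_subr.
Qed.

(** A summation bound common to several coefficients allows sums to be exchanged. *)
Lemma fps_exp_widen N f n : f 0%N = 0 -> (n < N)%N ->
  fps_exp f n = \sum_(k < N) (k`!%:R^-1 : rat) *: fps_exp_nat f k n.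
Proof.
move=> f0 lt_nN; rewrite /fps_exp.
rewrite (big_ord_widen N (fun k => (k`!%:R^-1 : rat) *: fps_exp_nat f k n)) //.
rewrite big_mkcond; apply: eq_bigr => k _; case: ltnP => // lt_nk.
by rewrite fps_exp_nat_eq0 ?scaler0.
Qed.

(** Termwise, the derivative of [f^(k+1)] is [(k+1) f' f^k], and [(k+1)/(k+1)! = 1/k!]. *)
Lemma fps_deriv_exp f : f 0%N = 0 ->
  fps_deriv (fps_exp f) =1 fps_mul (fps_deriv f) (fps_exp f).
Proof.
move=> f0 n; pose p := \poly_(i < n.+2) f i.
have termE k : fps_exp_nat f k.+1 n.+1 *+ n.+1 =
    fps_mul (fps_deriv f) (fps_exp_nat f k) n *+ k.+1.
  rewrite (@coef_fps_exp_nat n.+2) // -coef_deriv deriv_exp coefMn /=; congr (_ *+ _).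
  rewrite coefM; apply: eq_bigr => i _.
  rewrite coef_deriv coef_poly ltnS ltn_ord -coef_fps_exp_nat //.
  exact: leq_ltn_trans (leq_subr _ _) _.
rewrite {1}/fps_deriv {1}/fps_exp big_ord_recl /= scaler0 add0r -sumrMnl.
transitivity (\sum_(k < n.+1) (k`!%:R^-1 : rat) *:
    fps_mul (fps_deriv f) (fps_exp_nat f k) n).
  apply: eq_bigr => k _; rewrite scalerMnr termE -scaler_nat scalerA.
  by rewrite factS natrM invfM mulrAC mulVf ?mul1r // Num.Theory.pnatr_eq0.
under eq_bigr do rewrite scaler_sumr.
rewrite exchange_big /=; apply: eq_bigr => i _.
rewrite (@fps_exp_widen n.+1) ?ltnS ?leq_subr // mulr_sumr.
by apply: eq_bigr => k _; rewrite scalerAr.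
Qed.
End FormalDerivative.

(** * The differential equation and comparison of coefficients *)

Lemma fact_scale_deriv (R : comAlgType rat) (f : fps R) n :
  (n.+1`!%:R : rat) *: f n.+1 = (n`!%:R : rat) *: fps_deriv f n.
Proof. by rewrite /fps_deriv -scaler_nat scalerA factS natrM mulrC. Qed.

Theorem theorem3p3 :
  egf (fun n => A n.+1)
  =1 fps_mul (fps_exp fps_u)
       (fps_exp (fps_scale ('X : {poly rat})
                   (fps_sub (fps_sub (fps_exp fps_u) fps_u) fps_one))).
Proof.
set E : fps {poly rat} := fps_exp fps_u.
set f := fps_scale _ _; set B := fps_mul E (fps_exp f).
have fE n : f n = 'X * (E n - (n == 1%N)%:R - (n == 0%N)%:R) by [].
have EE n : E n = (n`!%:R^-1 : rat) *: 1 by apply: fps_exp_u.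
have f0 : f 0%N = 0 by rewrite fE EE invr1 scale1r subr0 subrr mulr0.
have B_deriv n : fps_deriv B n = B n + fps_mul (fps_deriv f) B n.
  rewrite fps_deriv_mul; congr (_ + _).
    apply: eq_fps_mul => // k; rewrite /fps_deriv !EE factS natrM -scaler_nat scalerA.
    by rewrite invfM mulVKf // Num.Theory.pnatr_eq0.
  rewrite -fps_mulCA; apply: eq_fps_mul => // k; exact: fps_deriv_exp.
pose G n := (n`!%:R : rat) *: B n.
(* This is [f' = t(e^u - 1)]; the factor [(k != 0)] removes the constant term of [e^u]. *)
have f_deriv k : fps_deriv f k = (k != 0%N)%:R * 'X * ((k`!%:R^-1 : rat) *: 1).
  rewrite /fps_deriv fE EE factS natrM.
  case: k => [|k] /=; first by rewrite subr0 !mul0r mul1r invr1 scale1r subrr mulr0.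
  rewrite !subr0 mul1r -mulrnAr -scaler_nat scalerA invfM mulVKf //.
  by rewrite Num.Theory.pnatr_eq0.
(* The coefficient of [u^n] in [B' = B + f' B], times [n!]; the factorials combine into the
   binomial. *)
have GS n : G n.+1 = G n + 'X * \sum_(i < n) G (n - i.+1)%N *+ 'C(n, i.+1).
  rewrite /G fact_scale_deriv B_deriv scalerDr; congr (_ + _).
  rewrite /fps_mul big_ord_recl f_deriv !mul0r add0r mulr_sumr scaler_sumr.
  apply: eq_bigr => i _; rewrite f_deriv mul1r /= /bump /= add1n.
  rewrite -mulrA scalerAr; congr (_ * _).
  rewrite -scalerAl mul1r scalerA -scaler_nat scalerA; congr (_ *: _).
  rewrite -(bin_fact (ltn_ord i)) 2!natrM mulrCA mulrAC divff ?mul1r //.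
  by rewrite Num.Theory.pnatr_eq0 -lt0n fact_gt0.
have G0 : G 0%N = 1.
  by rewrite /G fact0 scale1r /B /fps_mul big_ord1 EE /fps_exp big_ord1 /= !invr1 !scale1r mulr1.
have AG n : A n.+1 = G n.
  have := A_remaining n; rewrite (remaining_sum_closed G0 GS) ?iota_ltn_sorted ?mem_iota ?ltnn //.
  (* No letter exceeds the start value, so only [i = 0] survives, leaving ['X * G n]; then ['X]
     cancels. *)
  rewrite size_iota (eq_in_count (a2 := pred0)); last first.
    by move=> k; rewrite mem_iota /= => lt_kn; rewrite ltnNge ltnW.
  rewrite count_pred0 /= big_ord_recl big1 ?addr0 => [|i _]; last by rewrite bin_small.
  by rewrite subSS subn0; apply: mulfI; rewrite polyX_eq0.
by move=> n; rewrite /egf AG scalerA mulVf ?scale1r ?Num.Theory.pnatr_eq0 -?lt0n ?fact_gt0.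
Qed.
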